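(* Let $S$ be a numerical semigroup with multiplicity $m\ge 3$, genus $g$ and type $t$. Then $$|\mathcal{C}\ell(S)|=2^g-2^{g-t}+1$$ if and only if either $S=\{0\}\cup(m+\mathbb{N})$ or $S=\langle m,m+1,\dots,2m-2\rangle$.
   Context: $\mathbb{N}$ denotes the non-negative integers. A numerical semigroup $S$ is a submonoid of $(\mathbb{N},+)$ with finite complement in $\mathbb{N}$; $\langle A\rangle$ denotes the submonoid of $(\mathbb{N},+)$ generated by $A$. The multiplicity of $S$ is its smallest positive element. Its set of gaps is $\mathrm{G}(S)=\mathbb{N}\setminus S$ and its genus is $|\mathrm{G}(S)|$. The order $\le_S$ on $\mathbb{Z}$ is defined by $a\le_S b$ if and only if $b-a\in S$. The pseudo-Frobenius numbers of $S$ are the maximal elements of $\mathrm{G}(S)$ with respect to $\le_S$; their set is $\mathrm{PF}(S)$, and the type of $S$ is $|\mathrm{PF}(S)|$. An ideal of $S$ is a non-empty set $E\subseteq\mathbb{Z}$ with $S+E\subseteq E$ and such that $s+E\subseteq S$ for some $s\in S$. The set $\mathcal{I}(S)$ of ideals of $S$ is a commutative monoid under $I+J=\{i+j: i\in I, j\in J\}$, with identity $S$. Define the congruence $I\sim J$ if $I=z+J$ for some $z\in\mathbb{Z}$. The ideal class monoid is $\mathcal{C}\ell(S)=\mathcal{I}(S)/\sim$. *)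

(* Defs.v *)
From mathcomp Require Import all_boot all_order all_algebra.
From mathcomp Require Import all_classical.

Set Implicit Arguments.
Unset Strict Implicit.
Unset Printing Implicit Defensive.

Import Order.TTheory GRing.Theory Num.Theory.

Local Open Scope classical_set_scope.

Definition submonoid (M : set nat) : Prop :=
  M 0%N /\ forall x y : nat, M x -> M y -> M (x + y)%N.

Definition generated (A : set nat) : set nat := smallest submonoid A.

Definition gaps (S : set nat) : set nat := ~` S.

Definition numerical_semigroup (S : set nat) : Prop :=
  submonoid S /\ finite_set (gaps S).

Definition is_multiplicity (S : set nat) (m : nat) : Prop :=
  [/\ S m, (0 < m)%N & forall x : nat, S x -> (0 < x)%N -> (m <= x)%N].

Definition is_genus (S : set nat) (g : nat) : Prop := (gaps S #= `I_g)%card.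

Local Open Scope ring_scope.

(* [S] viewed as a subset of the integers. *)
Definition zset (S : set nat) : set int := [set n%:Z | n in S].

Definition leS (S : set nat) (a b : int) : Prop := zset S (b - a).

Definition pseudo_frobenius (S : set nat) : set nat :=
  [set x | gaps S x /\
           forall y : nat, gaps S y -> leS S x%:Z y%:Z -> y = x].

Definition is_type (S : set nat) (t : nat) : Prop :=
  (pseudo_frobenius S #= `I_t)%card.

Definition addset (I J : set int) : set int := [set i + j | i in I & j in J].

Definition translate (z : int) (E : set int) : set int := [set z + e | e in E].

Definition ideal (S : set nat) (E : set int) : Prop :=
  [/\ E !=set0,
      addset (zset S) E `<=` E
    & exists2 s : nat, S s & translate s%:Z E `<=` zset S].

Definition ideal_equiv (I J : set int) : Prop :=
  exists z : int, I = translate z J.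

Definition ideal_class (S : set nat) (I : set int) : set (set int) :=
  [set J | ideal S J /\ ideal_equiv I J].

(* The underlying set of the monoid Cl(S): the quotient of the set of ideals
   by [ideal_equiv], realized as the set of equivalence classes. *)
Definition ideal_class_monoid (S : set nat) : set (set (set int)) :=
  [set ideal_class S I | I in ideal S].

(* Main.v *)
(** Every ideal class has a unique representative with minimum 0, and such
    representatives are the sets S U X with X an up-set of the gaps ordered by
    <=_S.  A nonempty up-set of a finite poset contains a maximal element, which
    bounds the number of up-sets by 2^g - 2^(g-t) + 1; equality means that every
    set containing a maximal element is an up-set, i.e. that any y lying strictly
    above some x is the unique maximal element.  For the gaps, applying this to
    y - m <_S y shows that at most one gap F exceeds m.  There is none in the
    first family; otherwise S is symmetric and F = 2m - 1. *)

From mathcomp Require Import all_boot.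

Set Implicit Arguments.
Unset Strict Implicit.
Unset Printing Implicit Defensive.

(** * Counting the up-sets of a finite poset *)

Section Upsets.
Variables (T : finType) (r : rel T).

Definition upset (A : {set T}) :=
  [forall x in A, forall y, r x y ==> (y \in A)].

Definition maximals : {set T} := [set x | [forall y, r x y ==> (y == x)]].

Lemma upsetP (A : {set T}) :
  reflect (forall x y, x \in A -> r x y -> y \in A) (upset A).
Proof.
apply: (iffP forall_inP) => [up x y Ax rxy | up x Ax].
  by have /forallP/(_ y)/implyP := up x Ax; apply.
by apply/forallP => y; apply/implyP; apply: up Ax.
Qed.

Lemma maximalsP x : reflect (forall y, r x y -> y = x) (x \in maximals).
Proof.
rewrite inE; apply: (iffP forallP) => [mx y rxy | mx y].
  by have /implyP/(_ rxy)/eqP := mx y.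
by apply/implyP => /mx ->.
Qed.

Hypotheses (r_refl : reflexive r) (r_anti : antisymmetric r)
  (r_trans : transitive r).

(** An element of [A] with the fewest elements above it is maximal: anything above it has a
    principal up-set contained in its own, hence equal to it, and antisymmetry concludes. *)
Lemma upset_meets_maximals (A : {set T}) :
  upset A -> A != set0 -> exists2 x, x \in A & x \in maximals.
Proof.
move=> /upsetP upA /set0Pn [x0 Ax0].
pose up x := [set y | r x y].
case: (@arg_minnP _ x0 (mem A) (fun x => #|up x|) Ax0) => x Ax min_x.
exists x => //; apply/maximalsP => y rxy.
have sub_up : up y \subset up x.
  by apply/subsetP => z; rewrite !inE; apply: r_trans rxy.
have eq_up : up y = up x.
  by apply/eqP; rewrite eqEcard sub_up; apply: min_x; apply: upA rxy.
have : x \in up y by rewrite eq_up inE.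
by rewrite inE => ryx; apply: r_anti; rewrite ryx.
Qed.

(** The subsets that miss [M] are the subsets of its complement. *)
Lemma card_meeting (M : {set T}) :
  #|[set A : {set T} | A :&: M != set0]| = (2 ^ #|T| - 2 ^ (#|T| - #|M|))%N.
Proof.
have -> : [set A : {set T} | A :&: M != set0] = ~: powerset (~: M).
  by apply/setP => A; rewrite !inE setI_eq0 disjoints_subset.
by rewrite cardsCs setCK card_powerset [#|~: M|]cardsCs setCK -!cardsT
  -powersetT card_powerset.
Qed.

Lemma card_upsets :
  #|[set A | upset A]| = (2 ^ #|T| - 2 ^ (#|T| - #|maximals|) + 1)%N <->
  forall x y, r x y -> x != y -> maximals = [set y].
Proof.
set U := [set A | upset A].
have U0 : set0 \in U by rewrite inE; apply/upsetP => x y; rewrite inE.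
pose K := [set A : {set T} | A :&: maximals != set0].
have sub_UK : U :\ set0 \subset K.
  apply/subsetP => A; rewrite !inE => /andP[A0 upA].
  have [x Ax mx] := upset_meets_maximals upA A0.
  by apply/set0Pn; exists x; rewrite in_setI Ax.
rewrite -card_meeting (cardsD1 set0) U0 addnC.
(* The empty set accounts for the final 1, and the nonempty up-sets all lie in [K]; equal
   cardinality thus amounts to the reverse inclusion. *)
apply: (@iff_trans _ (K \subset U :\ set0)).
  split=> [/addIn eqUK | sub_KU].
    by have := sub_UK; rewrite subEproper properEcard eqUK ltnn andbF orbF
      => /eqP ->.
  by congr (_ + _); apply/eqP; rewrite eqn_leq !subset_leq_card.
split=> [/subsetP KU x y rxy ne_xy | max1].
  have [z _ mz] : exists2 z, z \in [set: T] & z \in maximals.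
    apply: upset_meets_maximals; last by apply/set0Pn; exists x; rewrite inE.
    by apply/upsetP => *; rewrite inE.
  have max_y w : w \in maximals -> w = y.
    (* The pair of [x] and [w] meets the maximal elements, so it is an up-set and contains [y];
       since [y] differs from [x], it is [w]. *)
    move=> mw; have : [set x; w] \in U :\ set0.
      by apply: KU; rewrite inE; apply/set0Pn; exists w; rewrite in_setI set22.
    rewrite !inE => /andP[_ /upsetP/(_ x y)]; rewrite !inE eqxx => /(_ isT rxy).
    by rewrite eq_sym (negPf ne_xy) => /eqP.
  apply/setP => w; rewrite in_set1; apply/idP/eqP => [/max_y //| ->].
  by rewrite -(max_y z).
apply/subsetP => A; rewrite !inE => /set0Pn[z]; rewrite in_setI => /andP[Az mz].
apply/andP; split; first by apply/set0Pn; exists z.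
apply/upsetP => x y Ax rxy; have [<- // | ne_xy] := eqVneq x y.
by move: mz; rewrite (max1 x y rxy ne_xy) in_set1 => /eqP <-.
Qed.

End Upsets.

(* Classification of the semigroups that satisfy the equality condition *)
Require Import Defs.
From mathcomp Require Import all_boot all_order all_algebra.
From mathcomp Require Import all_classical.
From mathcomp Require Import finmap zify.

Import GRing.Theory.

Local Open Scope classical_set_scope.

(* Here [x] is automatically a gap, strictly below [x + s] for [<=_S]. *)
Definition nonmaximal_below_one (S : set nat) :=
  forall x s, S s -> (0 < s)%N -> gaps S (x + s)%N ->
    pseudo_frobenius S = [set (x + s)%N].

Lemma leS_nat (S : set nat) (x y : nat) :
  leS S x%:Z y%:Z <-> (x <= y)%N /\ S (y - x)%N.
Proof.
split=> [[n Sn e] | [le_xy Sxy]]; last by exists (y - x)%N => //; lia.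
have -> : (y - x = n)%N by lia.
by split=> //; lia.
Qed.

(** Two elements that are at least [m] have sum at least 2m, so 2m - 1 is never reached; conversely,
    subtracting [m] leads down to the interval. *)
Lemma generated_interval (m : nat) : (3 <= m)%N ->
  generated [set n : nat | (m <= n <= 2 * m - 2)%N] =
  [set n | n = 0%N \/ (m <= n)%N /\ n <> (2 * m - 1)%N].
Proof.
move=> m3; rewrite /generated; set A := [set n : nat | _].
apply/seteqP; split.
  apply: smallest_sub => [|n /= /andP[? ?]]; last by right; lia.
  by split=> /= [|x y [->|[? ?]] [->|[? ?]]]; lia.
move=> n /= [->|[le_mn ne]] B [[B0 BD] AB]; first exact: B0.
elim/ltn_ind: n le_mn ne => n IH le_mn ne.
have [le_n|lt_n] := leqP n (2 * m - 2); first by apply: AB; rewrite /A /=; lia.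
have [e|ne2] := eqVneq (n - m)%N (2 * m - 1)%N.
  (* For n = 3m - 1, subtracting [m] would land on the excluded 2m - 1; since m >= 3, both m + 1 and
     2m - 2 are generators. *)
  have -> : n = ((m + 1) + (2 * m - 2))%N by lia.
  by apply: BD; apply: AB; rewrite /A /=; lia.
have -> : n = (m + (n - m))%N by lia.
by apply: BD; [apply: AB; rewrite /A /=; lia|apply: IH; lia].
Qed.

Lemma nonmaximal_below_one_classification (S : set nat) (m : nat) :
  submonoid S -> is_multiplicity S m -> (3 <= m)%N ->
  nonmaximal_below_one S <->
  (S = [set 0%N] `|` [set (m + n)%N | n in [set: nat]] \/
   S = generated [set n : nat | (m <= n <= 2 * m - 2)%N]).
Proof.
move=> [S0 SD] [Sm m_gt0 m_min] m3; rewrite generated_interval //.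
have S_small n : S n -> n = 0%N \/ (m <= n)%N.
  by case: n => [|n] Sn; [left|right; apply: m_min].
split=> [one|].
  have [small|] := pselect (forall y, gaps S y -> (y < m)%N).
    left; apply/seteqP; split=> [n /S_small [->|le_mn]|n [->//|[k _ <-]]].
    - by left.
    - by right; exists (n - m)%N => //; lia.
    - by apply: contrapT => /small; lia.
  move/existsNP => [F /not_implyP[gF /negP]]; rewrite -leqNgt => le_mF.
  have lt_mF : (m < F)%N.
    by rewrite ltn_neqAle le_mF andbT; apply/eqP => e; apply: gF; rewrite -e.
  have PFone y : gaps S y -> (m < y)%N -> pseudo_frobenius S = [set y].
    move=> gy lt_my; have e : ((y - m) + m = y)%N by lia.
    by rewrite -e; apply: one => //; rewrite e.
  have PF_F := PFone F gF lt_mF.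
  have large y : gaps S y -> (m < y)%N -> y = F.
    move=> gy lt_my; have : pseudo_frobenius S F by rewrite PF_F.
    by rewrite (PFone y gy lt_my).
  have gap_sub y s : gaps S y -> S s -> (s <= y)%N -> gaps S (y - s)%N.
    by move=> gy Ss le_sy Sys; apply: gy; rewrite -(subnK le_sy); apply: SD.
  have gFm : gaps S (F - m)%N by apply: gap_sub => //; lia.
  (* Otherwise F - m would be a second gap above [m]. *)
  have lt_F2m : (F < 2 * m)%N.
    rewrite ltnNge; apply/negP => le_2mF.
    have : (F - m = F)%N; last by lia.
    apply: large => //; suff: (F - m)%N <> m by lia.
    by move=> e; apply: gFm; rewrite e.
  have eF : F = (2 * m - 1)%N.
    apply: contrapT => neF.
    (* If F < 2m - 1, this number lies strictly between 0 and [m]. It is pseudo-Frobenius, against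
       the uniqueness of [F]: a gap strictly above it could only be [F], but the difference m - 1 is
       not in [S]. *)
    have gx : gaps S (F - (m - 1))%N by move=> /S_small; lia.
    have : ~ pseudo_frobenius S (F - (m - 1))%N by rewrite PF_F /=; lia.
    apply; split=> // y gy /leS_nat[le_xy Sd].
    have [e|ne] := eqVneq (y - (F - (m - 1)))%N 0%N; first by lia.
    have e : (F - (m - 1) + (y - (F - (m - 1))) = y)%N by lia.
    have yF : y = F.
      have : pseudo_frobenius S F by rewrite PF_F.
      by rewrite -{1}e in gy; rewrite (one _ _ Sd _ gy) ?lt0n // e => ->.
    by have := S_small _ Sd; lia.
  right; apply/seteqP; split=> n /=.
    move=> Sn; case: (S_small _ Sn) => [->|le_mn]; first by left.
    right; split=> // e.
    by apply: gF; rewrite eF -e.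
  case=> [->//|[le_mn ne]]; apply: contrapT => gn.
  apply: ne; rewrite -eF; apply: large => //.
  by rewrite ltn_neqAle le_mn andbT; apply/eqP => e; apply: gn; rewrite -e.
case=> eS x s Ss s_gt0 gxs.
  exfalso; apply: gxs; rewrite eS; right; exists (x + s - m)%N => //.
  by have := S_small _ Ss; lia.
have SE n : S n <-> n = 0%N \/ (m <= n)%N /\ n <> (2 * m - 1)%N by rewrite eS.
have gE n : gaps S n <-> (0 < n < m)%N \/ n = (2 * m - 1)%N.
  split=> [g|g /SE]; last by lia.
  by apply: contrapT => ?; apply: g; apply/SE; lia.
(* Since s >= m, the gap x + s is not below [m]. *)
have -> : (x + s = 2 * m - 1)%N.
  by move/gE: gxs => [?|//]; case/SE: Ss; lia.
apply/seteqP; split=> y /=.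
  move=> [/gE gy max_y]; case: gy => [gy|//].
  symmetry; apply: max_y; first by apply/gE; right.
  (* For 0 < y < m, the difference 2m - 1 - y is at least [m] and is not 2m - 1, so it lies in
     [S]. *)
  by apply/leS_nat; split; [lia|apply/SE; right; lia].
move=> ->; split=> [|z /gE gz /leS_nat[? _]]; last by lia.
by apply/gE; right.
Qed.

(** * Finiteness of the gaps and cardinalities of finite sets *)

Lemma finite_gaps_conductor (S : set nat) :
  finite_set (gaps S) -> exists c, forall n, (c <= n)%N -> S n.
Proof.
(* One more than the largest gap; without gaps the maximum is 0 and the bound 1 still holds. *)
move=> fin; exists (\max_(i : fset_set (gaps S)) fsval i).+1 => n lt_n.
apply: contrapT => gn.
have Gn : n \in fset_set (gaps S) by rewrite in_fset_set // mem_set.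
have := @leq_bigmax _ (fun i : fset_set (gaps S) => fsval i) [` Gn]%fset.
by rewrite leqNgt lt_n.
Qed.

Lemma card_eq_finset (T : finType) (A : {set T}) : ([set` A] #= `I_#|A|)%card.
Proof.
have -> : [set` A] = [set enum_val i | i in [set: 'I_#|A|]].
  apply/seteqP; split=> [x Ax|_ [i _ <-]]; last exact: enum_valP.
  by exists (enum_rank_in Ax x) => //; rewrite enum_rankK_in.
apply: card_eq_trans (inj_card_eq _) _; first exact: in2W enum_val_inj.
by rewrite card_eq_sym; apply: card_II.
Qed.

(** * Ideal classes and their representatives with minimum 0 *)

Local Open Scope ring_scope.

Lemma ideal_equiv_refl (I : set int) : ideal_equiv I I.
Proof.
exists 0; apply/seteqP; split=> [i Ii|_ [i Ii <-]]; last by rewrite add0r.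
by exists i; rewrite ?add0r.
Qed.

Lemma ideal_equiv_sym (I J : set int) : ideal_equiv I J -> ideal_equiv J I.
Proof.
move=> [z ->]; exists (- z); apply/seteqP; split=> [j Jj|_ [_ [j Jj <-] <-]].
  by exists (z + j); [exists j|rewrite addKr].
by rewrite addKr.
Qed.

Lemma ideal_equiv_trans (J I K : set int) :
  ideal_equiv I J -> ideal_equiv J K -> ideal_equiv I K.
Proof.
move=> [z ->] [w ->]; exists (z + w).
apply/seteqP; split=> [_ [_ [k Kk <-] <-]|_ [k Kk <-]].
  by exists k; rewrite // addrA.
by exists (w + k); [exists k|rewrite addrA].
Qed.

Lemma ideal_class_eq (S : set nat) (I J : set int) : ideal S J ->
  (ideal_class S I = ideal_class S J <-> ideal_equiv I J).
Proof.
move=> idJ; split=> [eIJ|eIJ].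
  have : ideal_class S J J by split=> //; apply: ideal_equiv_refl.
  by rewrite -eIJ => -[].
apply/seteqP; split=> K [idK eK]; split=> //; last exact: ideal_equiv_trans eK.
exact: ideal_equiv_trans (ideal_equiv_sym eIJ) eK.
Qed.

(* The ideals of [S] with minimum [0]. *)
Definition overideal (S : set nat) : set (set nat) :=
  [set X | S `<=` X /\ forall s x, S s -> X x -> X (s + x)%N].

Lemma ideal_overideal (S : set nat) (X : set nat) :
  numerical_semigroup S -> overideal S X -> ideal S (zset X).
Proof.
move=> [[S0 _] /finite_gaps_conductor[c cS]] [SX Xadd]; split.
- by exists 0; exists 0%N => //; apply: SX.
- move=> _ [_ [s Ss <-] [_ [x Xx <-] <-]].
  by exists (s + x)%N => //; apply: Xadd.
(* All integers from [c] on lie in [S], so [c] shifts any set of naturals into [S]. *)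
- exists c; first exact: cS.
  by move=> _ [_ [x Xx <-] <-]; exists (c + x)%N => //; apply/cS/leq_addr.
Qed.

(** Since s + I consists of naturals, it has a least element [n0], and [I] has minimum n0 - s.
    Translating this minimum to 0 gives a set that contains [S], because [I] absorbs [S]. *)
Lemma ideal_normalize (S : set nat) (I : set int) : ideal S I ->
  exists2 X, overideal S X & ideal_equiv I (zset X).
Proof.
move=> [[i0 Ii0] SI [s Ss sI]].
have I_nat i : I i -> exists n : nat, n%:Z = s%:Z + i.
  by move=> Ii; have [n _ <-] := sI _ (ex_intro2 _ _ i Ii erefl); exists n.
pose P (n : nat) := `[< I (n%:Z - s%:Z) >].
have exP : exists n, P n.
  have [n en] := I_nat _ Ii0; exists n; apply/asboolP.
  by rewrite en addrAC subrr add0r.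
case: (ex_minnP exP) => n0 /asboolP In0 min_n0.
exists [set n | I (n%:Z + (n0%:Z - s%:Z))].
  have Iadd (a : nat) i : S a -> I i -> I (a%:Z + i).
    by move=> Sa Ii; apply: SI; exists a%:Z; [exists a|exists i].
  split=> [n Sn|a n Sa In] /=; first exact: Iadd.
  by rewrite PoszD -addrA; apply: Iadd.
exists (n0%:Z - s%:Z); apply/seteqP.
split=> [i Ii|_ [_ [n In <-] <-]]; last by rewrite addrC.
have [k ek] := I_nat _ Ii.
have le_n0k : (n0 <= k)%N.
  by apply: min_n0; apply/asboolP; rewrite ek addrAC subrr add0r.
have ei : i = (k - n0)%N%:Z + (n0%:Z - s%:Z) by lia.
exists (k - n0)%N%:Z; last by rewrite addrC -ei.
by exists (k - n0)%N => //=; rewrite -ei.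
Qed.

(* Both sets have minimum [0], so the translation is trivial. *)
Lemma ideal_equiv_zset_inj (X Y : set nat) : X 0%N -> Y 0%N ->
  ideal_equiv (zset X) (zset Y) -> X = Y.
Proof.
move=> X0 Y0 [z eXY].
have [_ [y _ <-] ez] : translate z (zset Y) 0 by rewrite -eXY; exists 0%N.
have [x _ ez'] : zset X (z + 0) by rewrite eXY; exists 0 => //; exists 0%N.
have z0 : z = 0 by lia.
have zXY : zset X = zset Y.
  rewrite eXY z0; apply/seteqP; split=> [_ [j Yj <-]|j Yj].
    by rewrite add0r.
  by exists j; rewrite ?add0r.
have mem_zset (Z : set nat) n : zset Z n%:Z <-> Z n.
  by split=> [[k Zk [<-]]|Zn]; last exists n.
by apply/seteqP; split=> n; move/mem_zset; [rewrite zXY|rewrite -zXY];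
  move/mem_zset.
Qed.

(** Sending [X] to the class of [zset X] is onto by normalization and injective because the minimum
    0 fixes the translation. *)
Lemma card_ideal_class_monoid (S : set nat) : numerical_semigroup S ->
  (ideal_class_monoid S #= overideal S)%card.
Proof.
move=> nsS; have [[S0 _] _] := nsS.
have -> : ideal_class_monoid S =
    [set ideal_class S (zset X) | X in overideal S].
  apply/seteqP; split=> [_ [I idI <-]|_ [X oX <-]].
    have [X oX eIX] := ideal_normalize idI.
    exists X => //; symmetry; apply/ideal_class_eq => //.
    exact: ideal_overideal.
  by exists (zset X) => //; apply: ideal_overideal.
apply: inj_card_eq => X Y /set_mem oX /set_mem oY.
move/(ideal_class_eq _ (ideal_overideal nsS oY)).
by apply: ideal_equiv_zset_inj; [apply: oX.1|apply: oY.1].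
Qed.

Local Close Scope ring_scope.

(** * The poset of gaps and its up-sets *)

Section GapPoset.
Variable S : set nat.
Hypothesis nsS : numerical_semigroup S.

Let fin_gaps : finite_set (gaps S) := nsS.2.

(** A finite type, so that the count of up-sets applies; it holds every gap because the gaps are
    finite in number. *)
Definition gap_type : finType := fset_set (gaps S).

Definition gap_le : rel gap_type :=
  fun x y => `[< leS S (fsval x)%:Z (fsval y)%:Z >].

Lemma gap_leP (x y : gap_type) :
  reflect ((fsval x <= fsval y)%N /\ S (fsval y - fsval x)%N) (gap_le x y).
Proof. by apply: (equivP (asboolP _)); apply: leS_nat. Qed.

Lemma gap_le_refl : reflexive gap_le.
Proof.
by move=> x; apply/gap_leP; rewrite subnn; split=> //; case: nsS => -[].
Qed.

Lemma gap_le_anti : antisymmetric gap_le.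
Proof.
by move=> x y /andP[/gap_leP[? _] /gap_leP[? _]]; apply/val_inj => /=; lia.
Qed.

Lemma gap_le_trans : transitive gap_le.
Proof.
move=> y x z /gap_leP[le_xy Sxy] /gap_leP[le_yz Syz]; apply/gap_leP.
split; first exact: leq_trans le_yz.
have -> : (fsval z - fsval x =
  (fsval z - fsval y) + (fsval y - fsval x))%N by lia.
by case: nsS => -[_ SD] _; apply: SD.
Qed.

Lemma gapP (x : gap_type) : gaps S (fsval x).
Proof. by have := fsvalP x; rewrite in_fset_set // => /set_mem. Qed.

Lemma gap_ex (n : nat) : gaps S n -> exists x : gap_type, fsval x = n.
Proof.
move=> gn; have Gn : n \in fset_set (gaps S) by rewrite in_fset_set // mem_set.
by exists [` Gn]%fset.
Qed.

Lemma maximals_pseudo_frobenius (x : gap_type) :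
  x \in maximals gap_le <-> pseudo_frobenius S (fsval x).
Proof.
split=> [/maximalsP mx|[_ mx]].
  split=> [|_ /gap_ex[y <-] xy]; first exact: gapP.
  by rewrite (mx y) //; apply/asboolP.
apply/maximalsP => y /asboolP xy; apply/val_inj/mx => //; exact: gapP.
Qed.

Lemma card_gap_type (g : nat) : is_genus S g -> #|gap_type| = g.
Proof. by move=> /card_fset_set <-; rewrite cardfE. Qed.

Lemma card_maximals_gap_le (t : nat) : is_type S t -> #|maximals gap_le| = t.
Proof.
move=> tS; apply/card_eq_II; rewrite -(card_eqr tS) card_eq_sym.
have -> : pseudo_frobenius S = [set fsval x | x in [set` maximals gap_le]].
  apply/seteqP; split=> [n PFn|_ [x mx <-]]; last first.
    exact/maximals_pseudo_frobenius.
  have [x ex] := gap_ex PFn.1; exists x => //.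
  by apply/maximals_pseudo_frobenius; rewrite ex.
exact: card_eq_trans (inj_card_eq (in2W val_inj)) (card_eq_finset _).
Qed.

(** An overideal is determined by the gaps it contains, and its stability under adding [S] says that
    these gaps form an up-set. *)
Lemma card_overideal :
  (overideal S #= `I_#|[set A | upset gap_le A]%SET|)%card.
Proof.
have [[S0 SD] _] := nsS.
pose ext (A : {set gap_type}) := S `|` [set fsval x | x in [set` A]].
have extE A (x : gap_type) : ext A (fsval x) <-> x \in A.
  split=> [[/gapP//|[y Ay /val_inj <-//]]|Ax]; right; exists x => //.
apply: card_eq_trans _ (card_eq_finset _).
have -> : overideal S = [set ext A | A in [set` [set A | upset gap_le A]%SET]].
  apply/seteqP; split=> [X [SX Xadd]|_ [A /= + <-]].
    exists [set x : gap_type | `[< X (fsval x) >]]%SET.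
      rewrite /= inE; apply/upsetP => x y; rewrite !inE.
      move=> /asboolP Xx /gap_leP[le_xy Sxy]; apply/asboolP.
      by rewrite -(subnK le_xy); apply: Xadd.
    apply/seteqP; split=> [n [/SX//|[x /=]]|n Xn].
      by rewrite inE => /asboolP Xx <-.
    have [Sn|/gap_ex[x ex]] := pselect (S n); first by left.
    by right; exists x => //=; rewrite inE; apply/asboolP; rewrite ex.
  rewrite inE => /upsetP upA; split=> [n Sn|s n Ss]; first by left.
  move=> [Sn|[x Ax <-]]; first by left; apply: SD.
  have [Ssx|/gap_ex[y ey]] := pselect (S (s + fsval x)); first by left.
  right; exists y => //; apply: upA Ax _; apply/gap_leP.
  by rewrite ey leq_addl addnK.
apply: inj_card_eq => A B _ _ eAB; apply/finset.setP => x.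
by apply/idP/idP => /extE; [rewrite eAB|rewrite -eAB] => /extE.
Qed.

(** Being strictly above [x] means being x + s with [s] positive in [S], and [x] is a gap whenever x
    + s is one. *)
Lemma nonmaximal_below_one_gap_le :
  (forall x y, gap_le x y -> x != y -> maximals gap_le = [set y]%SET) <->
  nonmaximal_below_one S.
Proof.
have [[S0 SD] _] := nsS; split=> [one x s Ss s_gt0 gxs|one x y].
  have /gap_ex[u eu] : gaps S x by move=> Sx; apply: gxs; apply: SD.
  have [v ev] := gap_ex gxs.
  have max_v : maximals gap_le = [set v]%SET.
    apply: (one u); first by apply/gap_leP; rewrite eu ev leq_addr addKn.
    by apply/eqP => euv; move: ev; rewrite -euv eu; lia.
  apply/seteqP; split=> [n PFn|_ ->] /=; last first.
    by rewrite -ev; apply/maximals_pseudo_frobenius; rewrite max_v set11.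
  have [w ew] := gap_ex PFn.1; rewrite -ew in PFn *.
  move/maximals_pseudo_frobenius: PFn.
  by rewrite max_v finset.in_set1 -ev => /eqP ->.
move=> /gap_leP[le_xy Sxy] ne_xy.
have lt_xy : (fsval x < fsval y)%N.
  by rewrite ltn_neqAle le_xy andbT; apply: contra_neq ne_xy; apply: val_inj.
have PFy : pseudo_frobenius S = [set fsval y].
  rewrite -(subnKC le_xy); apply: one; rewrite ?subn_gt0 // subnKC //.
  exact: gapP.
apply/finset.setP => w; rewrite finset.in_set1; apply/idP/eqP.
  by move=> /maximals_pseudo_frobenius; rewrite PFy => /val_inj.
by move=> ->; apply/maximals_pseudo_frobenius; rewrite PFy.
Qed.

End GapPoset.

Theorem mainTheorem3 (S : set nat) (m g t : nat)
    (hS : numerical_semigroup S) (hm : is_multiplicity S m) (hm3 : (3 <= m)%N)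
    (hg : is_genus S g) (ht : is_type S t) :
  (ideal_class_monoid S #= `I_(2 ^ g - 2 ^ (g - t) + 1)%N)%card <->
  (S = [set 0%N] `|` [set (m + n)%N | n in [set: nat]] \/
   S = generated [set n : nat | (m <= n <= 2 * m - 2)%N]).
Proof.
apply: iff_trans (nonmaximal_below_one_classification hS.1 hm hm3).
apply: iff_trans (nonmaximal_below_one_gap_le hS).
have := card_upsets (@gap_le_refl S hS) (@gap_le_anti S) (@gap_le_trans S hS).
rewrite (card_gap_type hg) (card_maximals_gap_le hS ht).
(* Ideal classes, overideals and up-sets of gaps are equinumerous, which turns the claim into an
   equality of naturals. *)
apply: iff_trans; rewrite (card_eql (card_ideal_class_monoid hS)).
rewrite (card_eql (card_overideal hS)).
by split=> [/card_eq_II //|->].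
Qed.
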